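(* Let $U\subset\mathbb{R}^N$ be open, let $\{\beta_{ij}\}_{i\neq j}$ be smooth real functions on $U$ solving the Darboux-Egoroff equations: $\frac{\partial\beta_{ij}}{\partial u_k}=\beta_{ik}\beta_{kj}$ for $i,j,k$ pairwise different, $\beta_{ij}=\beta_{ji}$ and $\sum_{k=1}^N\frac{\partial\beta_{ij}}{\partial u_k}=0$ for $i\neq j$. Let $X_i:U\to\mathbb{R}^D$, $H_i:U\to\mathbb{R}$, $x:U\to\mathbb{R}^D$ be smooth with $\frac{\partial X_j}{\partial u_i}=\beta_{ji}X_i$, $\frac{\partial H_j}{\partial u_i}=\beta_{ij}H_i$ $(i\ne j)$ and $\frac{\partial x}{\partial u_i}=X_iH_i$. Let $V_1,V_2$ be finite-dimensional real coordinate spaces, and for $s=1,2$ let $\xi_{i,(s)}:U\to V_s$ be smooth with $\frac{\partial\xi_{j,(s)}}{\partial u_i}=\beta_{ji}\xi_{i,(s)}$ $(i\neq j)$ and $L_{(s)}$ a linear operator on $V_s$ such that $$\xi^*_{i,(s)}:=\xi_{i,(s)}^{\mathrm t}L_{(s)}=\Big(\frac{\partial\xi_{i,(s)}}{\partial u_i}+\sum_{k\ne i}\xi_{k,(s)}\beta_{ki}\Big)^{\mathrm t},\qquad i=1,\dots,N.$$ Let $\Omega_{st}:=\Omega(\xi_{(s)},\xi_{(t)}^* )$, $\Omega(X,\xi_{(s)}^* )$, $\Omega(\xi_{(s)},H)$ be potentials. Put $$\xi_i=\begin{pmatrix}\xi_{i,(1)}\\ \xi_{i,(2)}\end{pmatrix},\quad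 L=\begin{pmatrix}L_{(1)}&0\\0&L_{(2)}\end{pmatrix},\quad \Omega=\begin{pmatrix}\Omega_{11}&\Omega_{12}\\ \Omega_{21}&\Omega_{22}\end{pmatrix},$$ and suppose $L^{\mathrm t}\Omega=\Omega^{\mathrm t}L$, $\Omega+\Omega^{\mathrm t}=\sum_{k=1}^N\xi_k\otimes\xi_k^{\mathrm t}$, and that $\Omega$ and $\Omega_{22}$ are invertible on $U$. Then the vectorial symmetric Ribaucour transformation with data $(V_1\oplus V_2,\xi_i,L)$ coincides with the composition of the vectorial symmetric Ribaucour transformation with data $(V_2,\xi_{i,(2)},L_{(2)})$, whose result is denoted by ${}'$, followed by the vectorial symmetric Ribaucour transformation with data $(V_1,\xi'_{i,(1)},L_{(1)})$. That is: the data of both steps satisfy the requirements of a vectorial symmetric Ribaucour transformation, and the transformed $\hat\beta_{ij},\hat X_i,\hat H_i,\hat x$ obtained from the data $(V_1\oplus V_2,\xi_i,L)$ equal those obtained by performing the two steps successively.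
   Context: Vectors are columns, covectors are rows, ${}^{\mathrm t}$ is transpose. Given $\beta_{ij}$, column-valued $\eta_i:U\to V$ with $\frac{\partial\eta_j}{\partial u_i}=\beta_{ji}\eta_i$ and row-valued $\theta_i^*:U\to W^*$ with $\frac{\partial\theta^*_j}{\partial u_i}=\beta_{ij}\theta_i^*$ $(i\neq j)$, a potential $\Omega(\eta,\theta^* )$ is a smooth function with values in linear maps $W\to V$ with $\frac{\partial\Omega(\eta,\theta^* )}{\partial u_i}=\eta_i\theta_i^*$ for all $i$. It is defined up to an additive constant. The vectorial symmetric Ribaucour transformation with data $(V,\xi_i,L)$ is defined when $\beta$ solves the Darboux-Egoroff equations, $\xi_i:U\to V$ solves $\frac{\partial\xi_j}{\partial u_i}=\beta_{ji}\xi_i$ $(i\neq j)$, $L$ is a linear operator on $V$ with $\xi_i^*:=\xi_i^{\mathrm t}L=\big(\frac{\partial\xi_i}{\partial u_i}+\sum_{k\neq i}\xi_k\beta_{ki}\big)^{\mathrm t}$, and the potential $\Omega(\xi,\xi^* )$ is invertible with $L^{\mathrm t}\Omega(\xi,\xi^* )=\Omega(\xi,\xi^* )^{\mathrm t}L$ and $\Omega(\xi,\xi^* )+\Omega(\xi,\xi^* )^{\mathrm t}=\sum_k\xi_k\otimes\xi_k^{\mathrm t}$. It is given by $$\hat\beta_{ij}=\beta_{ij}-\xi_j^*\Omega(\xi,\xi^* )^{-1}\xi_i,\qquad \hat X_i=X_i-\Omega(X,\xi^* )\Omega(\xi,\xi^* )^{-1}\xi_i,$$ $$\hat H_i=H_i-\xi_i^*\Omega(\xi,\xi^*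 )^{-1}\Omega(\xi,H),\qquad \hat x=x-\Omega(X,\xi^* )\Omega(\xi,\xi^* )^{-1}\Omega(\xi,H).$$ For the data $(V_1\oplus V_2,\xi_i,L)$ one uses $\Omega(\xi,\xi^* )=\Omega$, $\Omega(X,\xi^* )=(\Omega(X,\xi^*_{(1)}),\Omega(X,\xi^*_{(2)}))$ and $\Omega(\xi,H)=\begin{pmatrix}\Omega(\xi_{(1)},H)\\ \Omega(\xi_{(2)},H)\end{pmatrix}$. In the first step one uses $\Omega(\xi_{(2)},\xi_{(2)}^* )=\Omega_{22}$ and the given $\Omega(X,\xi_{(2)}^* )$, $\Omega(\xi_{(2)},H)$. The first transformation also acts on the remaining data by $$\xi'_{i,(1)}=\xi_{i,(1)}-\Omega_{12}\Omega_{22}^{-1}\xi_{i,(2)},\qquad \xi'^*_{i,(1)}=\xi^*_{i,(1)}-\xi^*_{i,(2)}\Omega_{22}^{-1}\Omega_{21}.$$ In the second step the requirements are those listed above for $\beta'$, $\xi'_{i,(1)}$, $L_{(1)}$ (in particular $\xi'^*_{i,(1)}=\xi'^{\mathrm t}_{i,(1)}L_{(1)}$), and the potentials used are the transformed ones: $$\Omega(\xi'_{(1)},\xi'^*_{(1)})=\Omega_{11}-\Omega_{12}\Omega_{22}^{-1}\Omega_{21},\quad \Omega(X',\xi'^*_{(1)})=\Omega(X,\xi^*_{(1)})-\Omega(X,\xi^*_{(2)})\Omega_{22}^{-1}\Omega_{21},$$ $$\Omega(\xi'_{(1)},H')=\Omega(\xi_{(1)},H)-\Omega_{12}\Omega_{22}^{-1}\Omega(\xi_{(2)},H).$$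 *)

(* Defs.v *)
From HB Require Import structures.
From mathcomp Require Import all_boot all_order all_algebra.
From mathcomp Require Import all_classical all_reals all_analysis.

Set Implicit Arguments.
Unset Strict Implicit.
Unset Printing Implicit Defensive.

Import Order.TTheory GRing.Theory Num.Theory.
Import numFieldNormedType.Exports.
Local Open Scope classical_set_scope.
Local Open Scope ring_scope.

(* Vectors are columns and covectors are rows, except for the points
   u : 'rV[R]_N of the base. Functions on U are total functions on 'rV[R]_N
   whose values outside the open set U are irrelevant. *)

Definition pderiv (R : realType) (N : nat) (W : normedModType R)
    (i : 'I_N) (f : 'rV[R]_N -> W) (u : 'rV[R]_N) : W :=
  'D_(delta_mx 0 i) f u.

(* Class C^k on U: all iterated partial derivatives up to order k exist and
   are continuous at every point of U. *)
Fixpoint is_Ck (R : realType) (N : nat) (W : normedModType R)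
    (U : set 'rV[R]_N) (k : nat) (f : 'rV[R]_N -> W) : Prop :=
  (forall u, U u -> {for u, continuous f}) /\
  match k with
  | 0%N => True
  | k'.+1 => forall i : 'I_N,
      (forall u, U u -> derivable f u (delta_mx 0 i)) /\
      is_Ck U k' (pderiv i f)
  end.

Definition smooth_on (R : realType) (N : nat) (W : normedModType R)
    (U : set 'rV[R]_N) (f : 'rV[R]_N -> W) : Prop :=
  forall k, is_Ck U k f.

(* The diagonal functions beta i i are never constrained nor used. *)
Record darboux_egoroff (R : realType) (N : nat) (U : set 'rV[R]_N)
    (beta : 'I_N -> 'I_N -> 'rV[R]_N -> R^o) : Prop := DarbouxEgoroff {
  de_smooth : forall i j : 'I_N, i != j -> smooth_on U (beta i j);
  de_darboux : forall i j k : 'I_N, i != j -> j != k -> i != k ->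
    forall u, U u -> pderiv k (beta i j) u = beta i k u * beta k j u;
  de_sym : forall i j : 'I_N, i != j ->
    forall u, U u -> beta i j u = beta j i u;
  de_transl : forall i j : 'I_N, i != j ->
    forall u, U u -> \sum_(k < N) pderiv k (beta i j) u = 0
}.

Definition column_solution (R : realType) (N : nat) (W : normedModType R)
    (U : set 'rV[R]_N) (beta : 'I_N -> 'I_N -> 'rV[R]_N -> R^o)
    (eta : 'I_N -> 'rV[R]_N -> W) : Prop :=
  (forall i, smooth_on U (eta i)) /\
  (forall i j : 'I_N, i != j ->
     forall u, U u -> pderiv i (eta j) u = beta j i u *: eta i u).

Definition row_solution (R : realType) (N : nat) (W : normedModType R)
    (U : set 'rV[R]_N) (beta : 'I_N -> 'I_N -> 'rV[R]_N -> R^o)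
    (theta : 'I_N -> 'rV[R]_N -> W) : Prop :=
  (forall i, smooth_on U (theta i)) /\
  (forall i j : 'I_N, i != j ->
     forall u, U u -> pderiv i (theta j) u = beta i j u *: theta i u).

Definition is_potential (R : realType) (N p q : nat) (U : set 'rV[R]_N)
    (eta : 'I_N -> 'rV[R]_N -> 'cV[R]_p) (theta : 'I_N -> 'rV[R]_N -> 'rV[R]_q)
    (Om : 'rV[R]_N -> 'M[R]_(p, q)) : Prop :=
  smooth_on U Om /\
  (forall i u, U u -> pderiv i Om u = eta i u *m theta i u).

Definition scalar_row (R : realType) (N : nat)
    (H : 'I_N -> 'rV[R]_N -> R^o) (i : 'I_N) (u : 'rV[R]_N) : 'rV[R]_1 :=
  (H i u)%:M.

Record net (R : realType) (N D : nat) := Net {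
  net_beta : 'I_N -> 'I_N -> 'rV[R]_N -> R^o;  (* beta_ij *)
  net_X : 'I_N -> 'rV[R]_N -> 'cV[R]_D;       (* X_i *)
  net_H : 'I_N -> 'rV[R]_N -> R^o;            (* H_i *)
  net_x : 'rV[R]_N -> 'cV[R]_D                (* x *)
}.

(* The equation for x says that x is a potential Omega(X, H). *)
Definition egoroff_net (R : realType) (N D : nat) (U : set 'rV[R]_N)
    (E : net R N D) : Prop :=
  [/\ darboux_egoroff U (net_beta E), column_solution U (net_beta E) (net_X E),
      row_solution U (net_beta E) (net_H E) &
      smooth_on U (net_x E) /\
      (forall i u, U u -> pderiv i (net_x E) u = net_H E i u *: net_X E i u)].

(* xi^*_i := xi_i^t L *)
Definition costar (R : realType) (N n : nat)
    (xi : 'I_N -> 'rV[R]_N -> 'cV[R]_n) (L : 'M[R]_n)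
    (i : 'I_N) (u : 'rV[R]_N) : 'rV[R]_n :=
  (xi i u)^T *m L.

Definition costar_condition (R : realType) (N n : nat) (U : set 'rV[R]_N)
    (beta : 'I_N -> 'I_N -> 'rV[R]_N -> R^o)
    (xi : 'I_N -> 'rV[R]_N -> 'cV[R]_n) (L : 'M[R]_n) : Prop :=
  forall i u, U u ->
    costar xi L i u =
    (pderiv i (xi i) u + \sum_(k < N | k != i) beta k i u *: xi k u)^T.

(* Requirements on the data (V, xi, L), V = R^n, of a vectorial symmetric
   Ribaucour transformation of the net E, with the potentials
   Om = Omega(xi, xi^* ), OmX = Omega(X, xi^* ) and OmH = Omega(xi, H). *)
Record ribaucour_data (R : realType) (N D n : nat) (U : set 'rV[R]_N)
    (E : net R N D) (xi : 'I_N -> 'rV[R]_N -> 'cV[R]_n) (L : 'M[R]_n)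
    (Om : 'rV[R]_N -> 'M[R]_n) (OmX : 'rV[R]_N -> 'M[R]_(D, n))
    (OmH : 'rV[R]_N -> 'cV[R]_n) : Prop := RibaucourData {
  rd_net : egoroff_net U E;
  rd_xi : column_solution U (net_beta E) xi;
  rd_costar : costar_condition U (net_beta E) xi L;
  rd_Om : is_potential U xi (costar xi L) Om;
  rd_OmX : is_potential U (net_X E) (costar xi L) OmX;
  rd_OmH : is_potential U xi (scalar_row (net_H E)) OmH;
  rd_unit : forall u, U u -> Om u \in unitmx;
  rd_L : forall u, U u -> L^T *m Om u = (Om u)^T *m L;
  rd_sym : forall u, U u ->
    Om u + (Om u)^T = \sum_(k < N) xi k u *m (xi k u)^T
}.

(* Action of the transformation on columns, rows and potentials:
   Om = Omega(xi, xi^* ), A = Omega(eta, xi^* ), B = Omega(xi, theta) and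
   C = Omega(eta, theta). *)
Definition ribaucour_col (R : realType) (N n p : nat)
    (xi : 'I_N -> 'rV[R]_N -> 'cV[R]_n) (Om : 'rV[R]_N -> 'M[R]_n)
    (A : 'rV[R]_N -> 'M[R]_(p, n)) (eta : 'I_N -> 'rV[R]_N -> 'cV[R]_p)
    (i : 'I_N) (u : 'rV[R]_N) : 'cV[R]_p :=
  eta i u - A u *m invmx (Om u) *m xi i u.

Definition ribaucour_row (R : realType) (N n q : nat)
    (xis : 'I_N -> 'rV[R]_N -> 'rV[R]_n) (Om : 'rV[R]_N -> 'M[R]_n)
    (B : 'rV[R]_N -> 'M[R]_(n, q)) (theta : 'I_N -> 'rV[R]_N -> 'rV[R]_q)
    (i : 'I_N) (u : 'rV[R]_N) : 'rV[R]_q :=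
  theta i u - xis i u *m invmx (Om u) *m B u.

Definition ribaucour_pot (R : realType) (N n p q : nat)
    (Om : 'rV[R]_N -> 'M[R]_n) (A : 'rV[R]_N -> 'M[R]_(p, n))
    (B : 'rV[R]_N -> 'M[R]_(n, q)) (C : 'rV[R]_N -> 'M[R]_(p, q))
    (u : 'rV[R]_N) : 'M[R]_(p, q) :=
  C u - A u *m invmx (Om u) *m B u.

Definition ribaucour (R : realType) (N D n : nat)
    (E : net R N D) (xi : 'I_N -> 'rV[R]_N -> 'cV[R]_n) (L : 'M[R]_n)
    (Om : 'rV[R]_N -> 'M[R]_n) (OmX : 'rV[R]_N -> 'M[R]_(D, n))
    (OmH : 'rV[R]_N -> 'cV[R]_n) : net R N D :=
  {| net_beta := fun i j u =>
       net_beta E i j u - (costar xi L j u *m invmx (Om u) *m xi i u) 0 0;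
     net_X := ribaucour_col xi Om OmX (net_X E);
     net_H := fun i u =>
       net_H E i u - (costar xi L i u *m invmx (Om u) *m OmH u) 0 0;
     net_x := ribaucour_pot Om OmX OmH (net_x E) |}.

Definition net_eq_on (R : realType) (N D : nat) (U : set 'rV[R]_N)
    (E E' : net R N D) : Prop :=
  forall u, U u ->
    [/\ forall i j : 'I_N, i != j -> net_beta E i j u = net_beta E' i j u,
        forall i, net_X E i u = net_X E' i u,
        forall i, net_H E i u = net_H E' i u &
        net_x E u = net_x E' u].

(* Main.v *)
Require Import Defs.
From HB Require Import structures.
From mathcomp Require Import all_boot all_order all_algebra.
From mathcomp Require Import all_classical all_reals all_analysis.

From mathcomp Require Import ring.

Set Implicit Arguments.
Unset Strict Implicit.
Unset Printing Implicit Defensive.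

Import Order.TTheory GRing.Theory Num.Theory.
Import numFieldNormedType.Exports.
Local Open Scope classical_set_scope.
Local Open Scope ring_scope.

(** Write [a Om^-1 b] for the correction subtracted from [beta], [X], [H], [x] and
from the potentials.  Since the derivative of [Om^-1] along [u_i] is
[- Om^-1 xi_i xi^*_i Om^-1], the transform of anything whose derivative along
[u_i] is a product [eta theta] of a column and a row has as derivative the
product of the transforms of [eta] and [theta]; the equations for [beta],
columns, rows and potentials are all instances of this one identity.

For the Egoroff part let [D] be the sum of all partial derivatives.  The
condition defining [xi^*_i] says [D xi_i = L^t xi_i], and the two conditions on
[Om] give [D (a Om^-1 b) = (D a - a L) Om^-1 b + a Om^-1 (D b - L^t b)].  Both
terms vanish for [a = xi^*_j], [b = xi_i], so [D beta_ij = 0] is preserved, and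
[a = Om_12], [b = xi_i,(2)] yields the condition on [xi'_i,(1)].

The equality of the two transformations is block elimination for [Om], with the
transformed potential of the second step as the Schur complement. *)

(** * Derivatives and smoothness of matrix-valued functions *)

Section Derivatives.
Variables (R : realType) (V : normedModType R).
Implicit Types u v : V.

Lemma is_derive_mxP m n (f : V -> 'M[R]_(m, n)) u v df :
  is_derive u v f df <->
  forall i j, is_derive u v (fun w => f w i j : R^o) (df i j).
Proof.
split=> [[f_der <-] i j|entry].
  split; first exact: (derivable_mxP _ _ _).1.
  by rewrite derive_mx // mxE.
have f_der : derivable f u v by apply/derivable_mxP => i j; case: (entry i j).
split=> //; rewrite derive_mx //; apply/matrixP => i j; rewrite mxE.
by case: (entry i j).
Qed.

Lemma is_derive_mulmx m n p (f : V -> 'M[R]_(m, n)) (g : V -> 'M[R]_(n, p))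
    u v df dg :
  is_derive u v f df -> is_derive u v g dg ->
  is_derive u v (fun w => f w *m g w) (df *m g u + f u *m dg).
Proof.
move=> /is_derive_mxP f_der /is_derive_mxP g_der.
apply/is_derive_mxP => i j.
have -> : (fun w => (f w *m g w) i j : R^o) =
    \sum_(k < n) ((fun w => f w i k : R^o) * (fun w => g w k j : R^o)).
  by apply/funext => w; rewrite mxE fct_sumE.
have := is_derive_sum (fun k => is_deriveM (f_der i k) (g_der k j)).
move/is_derive_eq; apply; rewrite !mxE -big_split /=.
by apply: eq_bigr => k _; rewrite addrC /GRing.scale /= [_ * df i k]mulrC.
Qed.

Lemma is_derive_trmx m n (f : V -> 'M[R]_(m, n)) u v df :
  is_derive u v f df -> is_derive u v (fun w => (f w)^T) df^T.
Proof.
move=> /is_derive_mxP f_der; apply/is_derive_mxP => i j.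
by under [X in is_derive _ _ X]funext do rewrite mxE; rewrite mxE.
Qed.

End Derivatives.

(** * Functions of class C^k on an open set *)

Section Smoothness.
Variables (R : realType) (N : nat) (U : set 'rV[R]_N).
Hypothesis U_open : open U.
Implicit Types (W : normedModType R) (k : nat).

Lemma open_near_eq W (f g : 'rV[R]_N -> W) u :
  U u -> (forall w, U w -> f w = g w) -> \near u, f u = g u.
Proof.
move=> Uu fg; have /filterS : nbhs u U by exact: open_nbhs_nbhs.
exact.
Qed.

Lemma open_eq_continuous W (f g : 'rV[R]_N -> W) u :
  U u -> (forall w, U w -> f w = g w) ->
  {for u, continuous f} -> {for u, continuous g}.
Proof.
move=> Uu fg f_cont; rewrite /prop_for /continuous_at -fg //.
apply: cvg_trans f_cont.
exact: near_eq_cvg (open_near_eq Uu fg).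
Qed.

(** At a point of the open set [U], continuity and derivatives depend only on the germ, so values
    outside [U] do not matter. The inductions below use this to replace a derivative by a formula
    valid on [U]. *)
Lemma is_Ck_eq W k (f g : 'rV[R]_N -> W) :
  (forall u, U u -> f u = g u) -> is_Ck U k f -> is_Ck U k g.
Proof.
elim: k f g => [|k IHk] f g fg /= [f_cont f_der].
  by split=> // u Uu; exact: open_eq_continuous fg (f_cont u Uu).
split=> [u Uu|]; first exact: open_eq_continuous fg (f_cont u Uu).
move=> i; have [f_der1 f_der2] := f_der i; split=> [u Uu|].
  exact: near_eq_derivable (open_near_eq Uu fg) (f_der1 u Uu).
apply: IHk f_der2 => u Uu; exact: near_eq_derive (open_near_eq Uu fg).
Qed.

Lemma is_CkW W k (f : 'rV[R]_N -> W) : is_Ck U k.+1 f -> is_Ck U k f.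
Proof.
elim: k f => [|k IHk] f [f_cont f_der]; split=> // i.
have [f_der1 f_der2] := f_der i; split=> //; exact: IHk.
Qed.

Lemma is_Ck_cst W k (c : W) : is_Ck U k (fun _ => c).
Proof.
elim: k c => [|k IHk] c; split=> //.
all: try by move=> u _; exact: cst_continuous.
move=> i; split=> [u _|]; first exact: derivable_cst.
apply: is_Ck_eq (IHk 0) => u _; by rewrite /pderiv derive_cst.
Qed.

Lemma is_CkD W k (f g : 'rV[R]_N -> W) :
  is_Ck U k f -> is_Ck U k g -> is_Ck U k (fun u => f u + g u).
Proof.
elim: k f g => [|k IHk] f g [f_cont f_der] [g_cont g_der].
all: split=> [u Uu|].
all: try by apply: continuousD; [exact: f_cont|exact: g_cont].
  by [].
move=> i; have [f_der1 f_der2] := f_der i; have [g_der1 g_der2] := g_der i.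
split=> [u Uu|]; first by apply: derivableD; [exact: f_der1|exact: g_der1].
apply: is_Ck_eq (IHk _ _ f_der2 g_der2) => u Uu.
by rewrite [RHS]deriveD; [|exact: f_der1|exact: g_der1].
Qed.

Lemma is_CkN W k (f : 'rV[R]_N -> W) :
  is_Ck U k f -> is_Ck U k (fun u => - f u).
Proof.
elim: k f => [|k IHk] f [f_cont f_der].
all: split=> [u Uu|].
all: try by apply: continuousN; exact: f_cont.
  by [].
move=> i; have [f_der1 f_der2] := f_der i.
split=> [u Uu|]; first by apply: derivableN; exact: f_der1.
apply: is_Ck_eq (IHk _ f_der2) => u Uu.
by rewrite [RHS]deriveN //; exact: f_der1.
Qed.

Lemma is_CkM k (f g : 'rV[R]_N -> R^o) :
  is_Ck U k f -> is_Ck U k g -> is_Ck U k (fun u => f u * g u : R^o).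
Proof.
elim: k f g => [|k IHk] f g f_Ck g_Ck.
all: have [f_cont f_der] := f_Ck; have [g_cont g_der] := g_Ck.
all: split=> [u Uu|].
all: try by apply: continuousM; [exact: f_cont|exact: g_cont].
  by [].
move=> i; have [f_der1 f_der2] := f_der i; have [g_der1 g_der2] := g_der i.
split=> [u Uu|]; first by apply: derivableM; [exact: f_der1|exact: g_der1].
(* The Leibniz rule has factors of two kinds: derivatives, of class C^k by hypothesis, and [f], [g]
   themselves, lowered from C^(k+1) to C^k by [is_CkW]. *)
apply: (@is_Ck_eq _ _ (fun u => f u * pderiv i g u + g u * pderiv i f u)).
  by move=> u Uu; rewrite [RHS]deriveM; [|exact: f_der1|exact: g_der1].
by apply: is_CkD; apply: IHk => //; exact: is_CkW.
Qed.

(** The derivative - f^-2 f' contains the inverse itself, but only to order k is its regularity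
    required, so the induction closes. *)
Lemma is_CkV k (f : 'rV[R]_N -> R^o) :
  (forall u, U u -> f u != 0) -> is_Ck U k f ->
  is_Ck U k (fun u => (f u)^-1 : R^o).
Proof.
move=> f_neq0; elim: k => [|k IHk] f_Ck.
all: have [f_cont f_der] := f_Ck.
all: split=> [u Uu|].
all: try by apply: continuousV; [exact: f_neq0|exact: f_cont].
  by [].
move=> i; have [f_der1 f_der2] := f_der i.
split=> [u Uu|]; first by apply: derivableV; [exact: f_neq0|exact: f_der1].
have finv_Ck := IHk (is_CkW f_Ck).
apply: (@is_Ck_eq _ _
  (fun u => -1 * (((f u)^-1 * (f u)^-1) * pderiv i f u) : R^o)).
  move=> u Uu; rewrite [RHS]deriveV; [|exact: f_neq0|exact: f_der1].
  by rewrite -exprVn expr2 mulN1r scaleNr.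
by apply: is_CkM; [exact: is_Ck_cst|do 2 apply: is_CkM => //].
Qed.

(** Stated for an arbitrary operation preserving class C^k, so as to serve both sums and
    products. *)
Lemma is_Ck_big W k (op : W -> W -> W) (idx : W) (I : Type) (r : seq I)
    (P : pred I) (F : I -> 'rV[R]_N -> W) :
  (forall f g : 'rV[R]_N -> W, is_Ck U k f -> is_Ck U k g ->
     is_Ck U k (fun u => op (f u) (g u))) ->
  (forall i, is_Ck U k (F i)) ->
  is_Ck U k (fun u => \big[op/idx]_(i <- r | P i) F i u).
Proof.
move=> op_Ck F_Ck; elim: r => [|i r IHr].
  by apply: is_Ck_eq (is_Ck_cst k idx) => u _; rewrite big_nil.
have [Pi|/negbTE nPi] := boolP (P i).
  by apply: is_Ck_eq (op_Ck _ _ (F_Ck i) IHr) => u _; rewrite big_cons Pi.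
by apply: is_Ck_eq IHr => u _; rewrite big_cons nPi.
Qed.

Lemma continuous_mxP (T : topologicalType) m n (f : T -> 'M[R]_(m, n)) t :
  {for t, continuous f} <->
  forall i j, {for t, continuous (fun s => f s i j : R^o)}.
Proof.
split=> [ft i j|ft].
  exact: (cvg_comp f (fun M : 'M[R]_(m, n) => M i j) ft
    (@coord_continuous R m n i j (f t))).
(* A neighbourhood of a matrix contains a box of entrywise neighbourhoods [P i j]. There are
   finitely many entries, so all these conditions hold simultaneously near [t]. *)
move=> A [P ft_P sPA].
apply: (@filterS _ (nbhs t) _ (fun s => forall i j, P i j (f s i j))).
  by move=> s Ps; exact: sPA.
by apply: filter_forall => i; apply: filter_forall => j; exact: ft (ft_P i j).
Qed.

Lemma is_Ck_mxP k m n (f : 'rV[R]_N -> 'M[R]_(m, n)) :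
  is_Ck U k f <-> forall i j, is_Ck U k (fun u => f u i j : R^o).
Proof.
elim: k f => [|k IHk] f; split.
- move=> [f_cont _] i j; split=> // u Uu.
  exact: ((continuous_mxP f u).1 (f_cont u Uu) i j).
- move=> f_Ck; split=> // u Uu; apply/continuous_mxP => i j.
  by have [f_cont _] := f_Ck i j; exact: (f_cont u Uu).
- move=> [f_cont f_der] i j; split=> [u Uu|l].
    exact: ((continuous_mxP f u).1 (f_cont u Uu) i j).
  have [f_der1 f_der2] := f_der l.
  split=> [u Uu|]; first by apply: (derivable_mxP _ _ _).1; exact: f_der1.
  apply: is_Ck_eq ((IHk _).1 f_der2 i j) => u Uu.
  by rewrite /pderiv derive_mx ?mxE //; exact: f_der1.
move=> f_Ck; split=> [u Uu|l].
  apply/continuous_mxP => i j.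
  by have [f_cont _] := f_Ck i j; exact: (f_cont u Uu).
have f_der1 u : U u -> derivable f u (delta_mx 0 l).
  move=> Uu; apply/derivable_mxP => i j.
  by have [_ /(_ l)[f_der _]] := f_Ck i j; exact: f_der.
split=> //; apply/IHk => i j.
have [_ /(_ l)[_ f_der2]] := f_Ck i j.
apply: is_Ck_eq f_der2 => u Uu.
by rewrite /pderiv derive_mx ?mxE //; exact: f_der1.
Qed.

End Smoothness.

(** * Smooth matrix-valued functions and the derivative of the inverse *)

Section MatrixSmoothness.
Variables (R : realType) (N : nat) (U : set 'rV[R]_N).
Hypothesis U_open : open U.

Lemma smooth_eq (W : normedModType R) (f g : 'rV[R]_N -> W) :
  (forall u, U u -> f u = g u) -> smooth_on U f -> smooth_on U g.
Proof. by move=> fg f_smooth k; exact: is_Ck_eq fg (f_smooth k). Qed.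

Lemma smooth_mxP m n (f : 'rV[R]_N -> 'M[R]_(m, n)) :
  smooth_on U f <-> forall i j, smooth_on U (fun u => f u i j : R^o).
Proof.
split=> [f_smooth i j k|f_smooth k].
  exact: (is_Ck_mxP U_open k f).1.
by apply/is_Ck_mxP => // i j; exact: f_smooth.
Qed.

Lemma smooth_cst (W : normedModType R) (c : W) : smooth_on U (fun _ => c).
Proof. by move=> k; exact: is_Ck_cst. Qed.

Lemma smoothM (f g : 'rV[R]_N -> R^o) :
  smooth_on U f -> smooth_on U g -> smooth_on U (fun u => f u * g u : R^o).
Proof. by move=> f_smooth g_smooth k; exact: is_CkM. Qed.

Lemma smooth_sum (I : finType) (F : I -> 'rV[R]_N -> R^o) :
  (forall i, smooth_on U (F i)) -> smooth_on U (fun u => \sum_i F i u).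
Proof.
move=> F_smooth k; apply: is_Ck_big => // [f g f_Ck g_Ck|i].
  exact: is_CkD.
exact: F_smooth.
Qed.

Lemma smooth_prod (I : finType) (F : I -> 'rV[R]_N -> R^o) :
  (forall i, smooth_on U (F i)) -> smooth_on U (fun u => \prod_i F i u : R^o).
Proof.
move=> F_smooth k; apply: is_Ck_big => // [f g f_Ck g_Ck|i].
  exact: is_CkM.
exact: F_smooth.
Qed.

Lemma smoothB (W : normedModType R) (f g : 'rV[R]_N -> W) :
  smooth_on U f -> smooth_on U g -> smooth_on U (fun u => f u - g u).
Proof.
by move=> f_smooth g_smooth k; apply: is_CkD => //; exact: is_CkN.
Qed.

Lemma smooth_mulmx m n p (f : 'rV[R]_N -> 'M[R]_(m, n))
    (g : 'rV[R]_N -> 'M[R]_(n, p)) :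
  smooth_on U f -> smooth_on U g -> smooth_on U (fun u => f u *m g u).
Proof.
move=> /smooth_mxP f_smooth /smooth_mxP g_smooth; apply/smooth_mxP => i j.
pose s u : R^o := \sum_k f u i k * g u k j.
apply: (@smooth_eq _ s) => [u _|]; first by rewrite mxE.
by apply: smooth_sum => k; exact: smoothM.
Qed.

Lemma smooth_trmx m n (f : 'rV[R]_N -> 'M[R]_(m, n)) :
  smooth_on U f -> smooth_on U (fun u => (f u)^T).
Proof.
move=> /smooth_mxP f_smooth; apply/smooth_mxP => i j.
by apply: smooth_eq (f_smooth j i) => u _; rewrite mxE.
Qed.

(** By the Leibniz expansion the determinant is a polynomial in the entries. *)
Lemma smooth_det n (f : 'rV[R]_N -> 'M[R]_n) :
  smooth_on U f -> smooth_on U (fun u => \det (f u) : R^o).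
Proof.
move=> /smooth_mxP f_smooth.
apply: smooth_sum => s; apply: smoothM; first exact: smooth_cst.
by apply: smooth_prod => i; exact: f_smooth.
Qed.

(** By Cramer's formula each entry of the inverse is a cofactor divided by the determinant, which
    does not vanish on [U]. *)
Lemma smooth_invmx n (f : 'rV[R]_N -> 'M[R]_n) :
  (forall u, U u -> f u \in unitmx) -> smooth_on U f ->
  smooth_on U (fun u => invmx (f u)).
Proof.
move=> f_unit f_smooth; apply/smooth_mxP => i j.
(* The adjugate is the transposed cofactor matrix: entry (i, j) deletes row j and column i. *)
pose minor u := row' j (col' i (f u)).
pose s u : R^o := (\det (f u))^-1 * ((-1) ^+ (j + i) * \det (minor u)).
apply: (@smooth_eq _ s) => [u Uu|].
  by rewrite /invmx f_unit // !mxE.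
apply: smoothM => [k|].
  apply: is_CkV => // [u Uu|]; last exact: smooth_det.
  by rewrite -unitfE -unitmxE f_unit.
apply: smoothM; first exact: smooth_cst.
apply: smooth_det; apply/smooth_mxP => i' j'.
move/smooth_mxP: f_smooth => /(_ (lift j i') (lift i j')).
by apply: smooth_eq => u _; rewrite !mxE.
Qed.

Lemma smooth_scalar_mx (f : 'rV[R]_N -> R^o) :
  smooth_on U f -> smooth_on U (fun u => (f u)%:M : 'M[R]_1).
Proof.
move=> f_smooth; apply/smooth_mxP => i j.
by apply: smooth_eq f_smooth => u _; rewrite !ord1 mxE mulr1n.
Qed.

Lemma smooth_col_mx m1 m2 n (f1 : 'rV[R]_N -> 'M[R]_(m1, n))
    (f2 : 'rV[R]_N -> 'M[R]_(m2, n)) :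
  smooth_on U f1 -> smooth_on U f2 ->
  smooth_on U (fun u => col_mx (f1 u) (f2 u)).
Proof.
move=> /smooth_mxP f1_smooth /smooth_mxP f2_smooth; apply/smooth_mxP => i j.
case: (split_ordP i) => i' ->.
  by apply: smooth_eq (f1_smooth i' j) => u _; rewrite col_mxEu.
by apply: smooth_eq (f2_smooth i' j) => u _; rewrite col_mxEd.
Qed.

Lemma smooth_row_mx m n1 n2 (f1 : 'rV[R]_N -> 'M[R]_(m, n1))
    (f2 : 'rV[R]_N -> 'M[R]_(m, n2)) :
  smooth_on U f1 -> smooth_on U f2 ->
  smooth_on U (fun u => row_mx (f1 u) (f2 u)).
Proof.
move=> /smooth_mxP f1_smooth /smooth_mxP f2_smooth; apply/smooth_mxP => i j.
case: (split_ordP j) => j' ->.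
  by apply: smooth_eq (f1_smooth i j') => u _; rewrite row_mxEl.
by apply: smooth_eq (f2_smooth i j') => u _; rewrite row_mxEr.
Qed.

Lemma smooth_is_derive (W : normedModType R) (f : 'rV[R]_N -> W) i u :
  smooth_on U f -> U u -> is_derive u (delta_mx 0 i) f (pderiv i f u).
Proof.
by move=> /(_ 1%N)[_ /(_ i)[f_der _]] Uu; split=> //; exact: f_der.
Qed.

(** [smooth_invmx] provides the existence of the derivative; its value then follows by
    differentiating f f^-1 = 1, an identity that holds on [U] and hence near [u]. *)
Lemma is_derive_invmx n (f : 'rV[R]_N -> 'M[R]_n) i u :
  (forall w, U w -> f w \in unitmx) -> smooth_on U f -> U u ->
  is_derive u (delta_mx 0 i) (fun w => invmx (f w))
    (- (invmx (f u) *m pderiv i f u *m invmx (f u))).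
Proof.
move=> f_unit f_smooth Uu.
have finv_der := smooth_is_derive i (smooth_invmx f_unit f_smooth) Uu.
have prod_der := is_derive_mulmx (smooth_is_derive i f_smooth Uu) finv_der.
have cst_der := @is_derive_cst R _ _ (1%:M : 'M[R]_n) u (delta_mx 0 i).
have prod1 : \near u, 1%:M = f u *m invmx (f u).
  by apply: (open_near_eq U_open Uu) => w Uw; rewrite mulmxV ?f_unit.
have [_ der0] := near_eq_is_derive prod1 cst_der.
apply: (is_derive_eq finv_der).
have := @derive_val _ _ _ _ _ _ _ prod_der; rewrite der0 => /eqP.
rewrite eq_sym addrC addr_eq0 => /eqP /(congr1 (mulmx (invmx (f u)))).
by rewrite mulKmx ?f_unit // mulmxN mulmxA.
Qed.

End MatrixSmoothness.

(** * The vectorial Ribaucour transformation *)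

(** The hypothesis gives L^t = A^t L A^-1, in which the inverse of A^t cancels. This symmetry yields
    that of the transformed [beta], and the compatibility of xi'^* with [L1]. *)
Lemma mul_invmx_sym (F : fieldType) n (A L : 'M[F]_n) :
  A \in unitmx -> L^T *m A = A^T *m L -> (L *m invmx A)^T = L *m invmx A.
Proof.
move=> A_unit LA; rewrite trmx_mul trmx_inv.
have -> : L^T = A^T *m L *m invmx A by rewrite -LA mulmxK.
by rewrite -mulmxA mulKmx ?unitmx_tr.
Qed.

(** The left side is the derivative of C - A Om^-1 B when the derivatives of A, B, C and Om are eta
    xis, xi th, eta th and xi xis. Its four terms are the expansion of the product on the right. *)
Lemma ribaucour_factor (F : fieldType) n p q (Oi : 'M[F]_n) (A : 'M[F]_(p, n))
    (B : 'M[F]_(n, q)) (xi : 'cV[F]_n) (xis : 'rV[F]_n) (eta : 'cV[F]_p)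
    (th : 'rV[F]_q) :
  eta *m th - (eta *m xis *m Oi *m B - A *m Oi *m (xi *m xis) *m Oi *m B
               + A *m Oi *m (xi *m th)) =
  (eta - A *m Oi *m xi) *m (th - xis *m Oi *m B).
Proof.
by rewrite mulmxBl !mulmxBr !mulmxA !opprD !opprK !addrA [RHS]addrAC.
Qed.

Lemma is_derive_scalar_mx (R : realType) (V : normedModType R) (f : V -> R^o)
    (u v : V) df :
  is_derive u v f df -> is_derive u v (fun w => (f w)%:M : 'M[R]_1) df%:M.
Proof.
move=> f_der; apply/is_derive_mxP => i j; rewrite !ord1 mxE mulr1n.
have -> // : (fun w => ((f w)%:M : 'M[R]_1) 0 0 : R^o) = f.
by apply/funext => w; rewrite mxE mulr1n.
Qed.

(** * Transformation rules for potentials, columns, rows and [beta] *)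

Section RibaucourPotential.
Variables (R : realType) (N n : nat) (U : set 'rV[R]_N).
Hypothesis U_open : open U.
Variables (xi : 'I_N -> 'rV[R]_N -> 'cV[R]_n).
Variables (xis : 'I_N -> 'rV[R]_N -> 'rV[R]_n) (Om : 'rV[R]_N -> 'M[R]_n).
Hypothesis Om_pot : is_potential U xi xis Om.
Hypothesis Om_unit : forall u, U u -> Om u \in unitmx.
Implicit Types (p q : nat) (u : 'rV[R]_N).

Lemma smooth_mul_invmx p q (A : 'rV[R]_N -> 'M[R]_(p, n))
    (B : 'rV[R]_N -> 'M[R]_(n, q)) :
  smooth_on U A -> smooth_on U B ->
  smooth_on U (fun u => A u *m invmx (Om u) *m B u).
Proof.
move=> A_smooth B_smooth; do 2 apply: smooth_mulmx => //.
by apply: smooth_invmx => //; case: Om_pot.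
Qed.

Lemma smooth_ribaucour_pot p q (A : 'rV[R]_N -> 'M[R]_(p, n))
    (B : 'rV[R]_N -> 'M[R]_(n, q)) (C : 'rV[R]_N -> 'M[R]_(p, q)) :
  smooth_on U A -> smooth_on U B -> smooth_on U C ->
  smooth_on U (ribaucour_pot Om A B C).
Proof.
by move=> A_smooth B_smooth C_smooth; apply: smoothB => //;
  exact: smooth_mul_invmx.
Qed.

Lemma is_derive_mul_invmx p q (A : 'rV[R]_N -> 'M[R]_(p, n))
    (B : 'rV[R]_N -> 'M[R]_(n, q)) i u dA dB :
  U u -> is_derive u (delta_mx 0 i) A dA -> is_derive u (delta_mx 0 i) B dB ->
  is_derive u (delta_mx 0 i) (fun w => A w *m invmx (Om w) *m B w)
    (dA *m invmx (Om u) *m B u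
     - A u *m invmx (Om u) *m (xi i u *m xis i u) *m invmx (Om u) *m B u
     + A u *m invmx (Om u) *m dB).
Proof.
have [Om_smooth Om_der] := Om_pot => Uu A_der B_der.
have Oi_der := is_derive_invmx U_open i Om_unit Om_smooth Uu.
have AOi_der := is_derive_mulmx A_der Oi_der.
have := is_derive_mulmx AOi_der B_der.
move/is_derive_eq; apply; rewrite Om_der //.
by rewrite mulmxDl mulmxN mulNmx !mulmxA.
Qed.

(* Besides potentials, [C] can be a column eta_j, whose derivative is eta_i times
   the 1x1 row beta_ji, a row theta_j, or beta_ij itself. *)
Lemma is_derive_ribaucour_pot p q (A : 'rV[R]_N -> 'M[R]_(p, n))
    (B : 'rV[R]_N -> 'M[R]_(n, q)) (C : 'rV[R]_N -> 'M[R]_(p, q)) i u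
    (eta : 'cV[R]_p) (th : 'rV[R]_q) :
  U u -> is_derive u (delta_mx 0 i) A (eta *m xis i u) ->
  is_derive u (delta_mx 0 i) B (xi i u *m th) ->
  is_derive u (delta_mx 0 i) C (eta *m th) ->
  is_derive u (delta_mx 0 i) (ribaucour_pot Om A B C)
    ((eta - A u *m invmx (Om u) *m xi i u) *m
     (th - xis i u *m invmx (Om u) *m B u)).
Proof.
move=> Uu A_der B_der C_der; rewrite -ribaucour_factor.
by apply: is_deriveB => //; exact: is_derive_mul_invmx.
Qed.

Lemma ribaucour_pot_potential p q (eta : 'I_N -> 'rV[R]_N -> 'cV[R]_p)
    (theta : 'I_N -> 'rV[R]_N -> 'rV[R]_q) (A : 'rV[R]_N -> 'M[R]_(p, n))
    (B : 'rV[R]_N -> 'M[R]_(n, q)) (C : 'rV[R]_N -> 'M[R]_(p, q)) :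
  is_potential U eta xis A -> is_potential U xi theta B ->
  is_potential U eta theta C ->
  is_potential U (ribaucour_col xi Om A eta) (ribaucour_row xis Om B theta)
    (ribaucour_pot Om A B C).
Proof.
move=> [A_smooth A_der] [B_smooth B_der] [C_smooth C_der].
split=> [|i u Uu]; first exact: smooth_ribaucour_pot.
apply: derive_val; apply: is_derive_ribaucour_pot => //.
- by rewrite -A_der //; exact: smooth_is_derive Uu.
- by rewrite -B_der //; exact: smooth_is_derive Uu.
- by rewrite -C_der //; exact: smooth_is_derive Uu.
Qed.

Variable beta : 'I_N -> 'I_N -> 'rV[R]_N -> R^o.
Hypothesis xi_sol : column_solution U beta xi.
Hypothesis xis_sol : row_solution U beta xis.

(** Here [xis] is an arbitrary row solution; with [xis] equal to [costar xi L] this is the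
    [net_beta] of [ribaucour]. *)
Definition ribaucour_beta (i j : 'I_N) (u : 'rV[R]_N) : R^o :=
  beta i j u - (xis j u *m invmx (Om u) *m xi i u) 0 0.

Lemma ribaucour_beta_scalar i j u :
  (ribaucour_beta i j u)%:M =
  (beta i j u)%:M - xis j u *m invmx (Om u) *m xi i u :> 'M[R]_1.
Proof.
rewrite /ribaucour_beta; move: (_ *m _ *m _) => M.
by apply/matrixP => a b; rewrite !ord1 !mxE eqxx !mulr1n.
Qed.

(** Viewed as a 1x1 matrix, the transformed [beta i j] has the shape C - A Om^-1 B with A = xi^*_j
    and B = xi_i, so that [is_derive_ribaucour_pot] applies to it. *)
Lemma ribaucour_betaE i j :
  ribaucour_beta i j = fun u =>
    ribaucour_pot Om (xis j) (xi i) (fun w => (beta i j w)%:M) u 0 0.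
Proof.
by apply/funext => u; rewrite /ribaucour_pot -ribaucour_beta_scalar mxE mulr1n.
Qed.

Lemma is_derive_xi i j u : i != j -> U u ->
  is_derive u (delta_mx 0 i) (xi j) (xi i u *m (beta j i u)%:M).
Proof.
have [xi_smooth xi_der] := xi_sol => ij Uu.
by rewrite mul_mx_scalar -xi_der //; exact: smooth_is_derive.
Qed.

Lemma is_derive_xis i j u : i != j -> U u ->
  is_derive u (delta_mx 0 i) (xis j) ((beta i j u)%:M *m xis i u).
Proof.
have [xis_smooth xis_der] := xis_sol => ij Uu.
by rewrite mul_scalar_mx -xis_der //; exact: smooth_is_derive.
Qed.

Lemma ribaucour_col_solution p (eta : 'I_N -> 'rV[R]_N -> 'cV[R]_p) A :
  column_solution U beta eta -> is_potential U eta xis A ->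
  column_solution U ribaucour_beta (ribaucour_col xi Om A eta).
Proof.
move=> [eta_smooth eta_der] [A_smooth A_der].
split=> [i|i j ij u Uu].
  by apply: smooth_ribaucour_pot => //; case: xi_sol.
(* The transformed eta_j has B = xi_j, so the row factor of its derivative is beta_ji - xi^*_i Om^-1
   xi_j, which is the transformed beta_ji. *)
rewrite -mul_mx_scalar ribaucour_beta_scalar.
apply: derive_val; apply: is_derive_ribaucour_pot => //.
- by rewrite -A_der //; exact: smooth_is_derive Uu.
- exact: is_derive_xi.
- by rewrite mul_mx_scalar -eta_der //; exact: smooth_is_derive Uu.
Qed.

Lemma ribaucour_row_solution q (theta : 'I_N -> 'rV[R]_N -> 'rV[R]_q) B :
  row_solution U beta theta -> is_potential U xi theta B ->
  row_solution U ribaucour_beta (ribaucour_row xis Om B theta).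
Proof.
move=> [theta_smooth theta_der] [B_smooth B_der].
split=> [i|i j ij u Uu].
  by apply: smooth_ribaucour_pot => //; case: xis_sol.
rewrite -mul_scalar_mx ribaucour_beta_scalar.
apply: derive_val; apply: is_derive_ribaucour_pot => //.
- exact: is_derive_xis.
- by rewrite -B_der //; exact: smooth_is_derive Uu.
- by rewrite mul_scalar_mx -theta_der //; exact: smooth_is_derive Uu.
Qed.

Lemma smooth_ribaucour_beta i j :
  smooth_on U (beta i j) -> smooth_on U (ribaucour_beta i j).
Proof.
move=> beta_smooth; rewrite ribaucour_betaE.
apply: (smooth_mxP U_open _).1.
apply: smooth_ribaucour_pot; last exact: smooth_scalar_mx.
  by case: xis_sol.
by case: xi_sol.
Qed.

Lemma pderiv_ribaucour_beta i j k u :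
  smooth_on U (beta i j) ->
  pderiv k (beta i j) u = beta i k u * beta k j u ->
  j != k -> i != k -> U u ->
  pderiv k (ribaucour_beta i j) u = ribaucour_beta i k u * ribaucour_beta k j u.
Proof.
move=> beta_smooth beta_der jk ik Uu.
rewrite ribaucour_betaE; apply: derive_val.
(* The column factor comes from the derivative of xi^*_j and carries beta_kj, the row factor comes
   from xi_i and carries beta_ik; hence the reversed order of the two scalars. *)
have -> : ribaucour_beta i k u * ribaucour_beta k j u =
    ((ribaucour_beta k j u)%:M *m (ribaucour_beta i k u)%:M : 'M[R]_1) 0 0.
  by rewrite -scalar_mxM mxE mulr1n mulrC.
apply: (is_derive_mxP _ _ _ _).1.
rewrite !ribaucour_beta_scalar; apply: is_derive_ribaucour_pot => //.
- by apply: is_derive_xis; rewrite // eq_sym.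
- by apply: is_derive_xi; rewrite // eq_sym.
rewrite -scalar_mxM mulrC -beta_der.
by apply: is_derive_scalar_mx; exact: smooth_is_derive.
Qed.

End RibaucourPotential.

(** * Symmetric data *)

Section SymmetricRibaucour.
Variables (R : realType) (N n : nat) (U : set 'rV[R]_N).
Hypothesis U_open : open U.
Variable beta : 'I_N -> 'I_N -> 'rV[R]_N -> R^o.
Hypothesis beta_sym :
  forall i j, i != j -> forall u, U u -> beta i j u = beta j i u.

Lemma pderiv_costar m (xi : 'I_N -> 'rV[R]_N -> 'cV[R]_m) (L : 'M[R]_m) i j u :
  smooth_on U (xi j) -> U u ->
  pderiv i (costar xi L j) u = (pderiv i (xi j) u)^T *m L.
Proof.
move=> xi_smooth Uu; apply: derive_val.
have xi_der := is_derive_trmx (smooth_is_derive i xi_smooth Uu).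
have L_der := @is_derive_cst R _ _ L u (delta_mx 0 i).
have := is_derive_mulmx xi_der L_der.
by move/is_derive_eq; apply; rewrite mulmx0 addr0.
Qed.

Lemma smooth_costar m (xi : 'I_N -> 'rV[R]_N -> 'cV[R]_m) (L : 'M[R]_m) j :
  smooth_on U (xi j) -> smooth_on U (costar xi L j).
Proof.
move=> xi_smooth; apply: smooth_mulmx => //; last exact: smooth_cst.
exact: smooth_trmx.
Qed.

Lemma costar_row_solution m (xi : 'I_N -> 'rV[R]_N -> 'cV[R]_m) (L : 'M[R]_m) :
  column_solution U beta xi -> row_solution U beta (costar xi L).
Proof.
move=> [xi_smooth xi_der]; split=> [i|i j ij u Uu]; first exact: smooth_costar.
by rewrite pderiv_costar // xi_der // linearZ /= -scalemxAl (beta_sym ij).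
Qed.

(** For k different from i the derivative of xi_i along u_k is beta_ik xi_k, which by symmetry is
    beta_ki xi_k. The right side of the condition is therefore the sum of all partial derivatives of
    xi_i. *)
Lemma costar_conditionP m (xi : 'I_N -> 'rV[R]_N -> 'cV[R]_m) (L : 'M[R]_m) :
  column_solution U beta xi ->
  costar_condition U beta xi L <->
  forall i u, U u -> \sum_k pderiv k (xi i) u = L^T *m xi i u.
Proof.
move=> [_ xi_der].
have total i u : U u -> \sum_k pderiv k (xi i) u =
    pderiv i (xi i) u + \sum_(k < N | k != i) beta k i u *: xi k u.
  move=> Uu; rewrite (bigD1 i) //=; congr (_ + _).
  by apply: eq_bigr => k ki; rewrite xi_der // beta_sym // eq_sym.
split=> costar_xi i u Uu; have := costar_xi i u Uu; rewrite total //.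
  by rewrite /costar => /(congr1 trmx); rewrite trmx_mul !trmxK.
by move=> ->; rewrite /costar trmx_mul trmxK.
Qed.

Variables (xi : 'I_N -> 'rV[R]_N -> 'cV[R]_n) (L : 'M[R]_n).
Variable Om : 'rV[R]_N -> 'M[R]_n.
Hypothesis xi_sol : column_solution U beta xi.
Hypothesis xi_costar : costar_condition U beta xi L.
Hypothesis Om_pot : is_potential U xi (costar xi L) Om.
Hypothesis Om_unit : forall u, U u -> Om u \in unitmx.
Hypothesis Om_L : forall u, U u -> L^T *m Om u = (Om u)^T *m L.
Hypothesis Om_sym : forall u, U u ->
  Om u + (Om u)^T = \sum_(k < N) xi k u *m (xi k u)^T.

(** The sum of the derivatives of Om is (Om + Om^t) L = Om L + L^t Om, so that of Om^-1 is - (L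
    Om^-1 + Om^-1 L^t). Its first term joins the derivative of A, its second that of B. *)
Lemma sum_pderiv_mul_invmx p q (A : 'rV[R]_N -> 'M[R]_(p, n))
    (B : 'rV[R]_N -> 'M[R]_(n, q)) u :
  smooth_on U A -> smooth_on U B -> U u ->
  \sum_k pderiv k (fun w => A w *m invmx (Om w) *m B w) u =
  (\sum_k pderiv k A u - A u *m L) *m invmx (Om u) *m B u
  + A u *m invmx (Om u) *m (\sum_k pderiv k B u - L^T *m B u).
Proof.
move=> A_smooth B_smooth Uu.
have sum_Om : \sum_k xi k u *m costar xi L k u = (Om u + (Om u)^T) *m L.
  by rewrite Om_sym // mulmx_suml; apply: eq_bigr => k _; rewrite mulmxA.
(* [Om_L] turns Om^t L into L^t Om, so that one factor Om^-1 cancels in each term. *)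
have mid : invmx (Om u) *m ((Om u + (Om u)^T) *m L) *m invmx (Om u) =
    L *m invmx (Om u) + invmx (Om u) *m L^T.
  rewrite mulmxDl mulmxDr mulKmx ?Om_unit // -Om_L // mulmxDl.
  by rewrite mulmxA mulmxK ?Om_unit.
transitivity ((\sum_k pderiv k A u) *m invmx (Om u) *m B u
    - A u *m (invmx (Om u) *m ((Om u + (Om u)^T) *m L) *m invmx (Om u)) *m B u
    + A u *m invmx (Om u) *m \sum_k pderiv k B u).
  rewrite -sum_Om mulmx_sumr !mulmx_suml !mulmx_sumr !mulmx_suml -sumrB.
  rewrite -big_split /=; apply: eq_bigr => k _.
  have A_der := smooth_is_derive k A_smooth Uu.
  have B_der := smooth_is_derive k B_smooth Uu.
  have [_ der] := is_derive_mul_invmx U_open Om_pot Om_unit Uu A_der B_der.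
  by rewrite /pderiv der !mulmxA.
rewrite mid mulmxDr mulmxDl mulmxBr !mulmxBl !mulmxA opprD !addrA.
by rewrite [in RHS]addrAC.
Qed.

Lemma pderivB (W : normedModType R) (f g : 'rV[R]_N -> W) k u :
  smooth_on U f -> smooth_on U g -> U u ->
  pderiv k (fun w => f w - g w) u = pderiv k f u - pderiv k g u.
Proof.
move=> /smooth_is_derive f_der /smooth_is_derive g_der Uu.
apply: derive_val; apply: is_deriveB; [exact: f_der|exact: g_der].
Qed.

Lemma pderiv_mx p q (f : 'rV[R]_N -> 'M[R]_(p, q)) k u i j :
  smooth_on U f -> U u ->
  pderiv k (fun w => f w i j : R^o) u = pderiv k f u i j.
Proof.
move=> f_smooth Uu; apply: derive_val.
by apply: (is_derive_mxP _ _ _ _).1; exact: smooth_is_derive.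
Qed.

Lemma darboux_egoroff_ribaucour_beta :
  darboux_egoroff U beta ->
  darboux_egoroff U (ribaucour_beta xi (costar xi L) Om beta).
Proof.
move=> [beta_smooth beta_der _ beta_transl].
have xis_sol := costar_row_solution L xi_sol.
have [xi_smooth _] := xi_sol; have [xis_smooth _] := xis_sol.
split=> [i j ij|i j k ij jk ik u Uu|i j ij u Uu|i j ij u Uu].
- exact: (smooth_ribaucour_beta U_open Om_pot Om_unit xi_sol xis_sol
    (beta_smooth _ _ ij)).
- exact: (pderiv_ribaucour_beta U_open Om_pot Om_unit xi_sol xis_sol
    (beta_smooth _ _ ij) (beta_der _ _ _ ij jk ik _ Uu)).
- rewrite /ribaucour_beta beta_sym //; congr (_ - _).
  (* The correction is the bilinear form of the symmetric matrix L Om^-1 at xi_j and xi_i;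
     transposing the 1x1 matrix exchanges i and j. *)
  rewrite -[in RHS](trmxK (_ *m xi j u)) [in RHS]mxE /costar.
  rewrite -!(mulmxA _ L) 2!trmx_mul trmxK mul_invmx_sym ?Om_unit ?Om_L //.
  by rewrite !mulmxA.
pose Q w := costar xi L j w *m invmx (Om w) *m xi i w.
have Q_smooth : smooth_on U Q := smooth_mul_invmx U_open Om_pot Om_unit
  (xis_smooth j) (xi_smooth i).
have Q00_smooth : smooth_on U (fun w => Q w 0 0 : R^o).
  exact: (smooth_mxP U_open Q).1.
transitivity (\sum_k (pderiv k (beta i j) u - pderiv k Q u 0 0)).
  apply: eq_bigr => k _; rewrite -pderiv_mx // -pderivB //.
  exact: beta_smooth.
rewrite sumrB beta_transl // sub0r -summxE sum_pderiv_mul_invmx //.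
have D_xi := (costar_conditionP L xi_sol).1 xi_costar.
under eq_bigr do rewrite pderiv_costar //.
rewrite -mulmx_suml -raddf_sum /= !D_xi // trmx_mul trmxK !subrr.
by rewrite !mul0mx mulmx0 addr0 mxE oppr0.
Qed.

End SymmetricRibaucour.

(** * The transformed Egoroff net *)

Section TransformedNet.
Variables (R : realType) (N D n : nat) (U : set 'rV[R]_N).
Hypothesis U_open : open U.

Lemma scalar_row_solutionP (beta : 'I_N -> 'I_N -> 'rV[R]_N -> R^o)
    (H : 'I_N -> 'rV[R]_N -> R^o) :
  row_solution U beta (scalar_row H) <-> row_solution U beta H.
Proof.
have entry i : (fun u => scalar_row H i u 0 0 : R^o) = H i.
  by apply/funext => u; rewrite mxE mulr1n.
split=> [[H_smooth H_der]|[H_smooth H_der]].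
  split=> [i|i j ij u Uu]; first by rewrite -entry; exact: (smooth_mxP _ _).1.
  rewrite -(entry j) (pderiv_mx i 0 0 (H_smooth j) Uu) H_der //.
  by rewrite mxE -[in RHS]entry.
split=> [i|i j ij u Uu]; first exact: smooth_scalar_mx.
have Hj_der := smooth_is_derive i (H_smooth j) Uu.
have [_ der] := is_derive_scalar_mx Hj_der; rewrite [LHS]der H_der //.
by rewrite /scalar_row scale_scalar_mx.
Qed.

(** Reading x as Omega(X, H) makes its transformation an instance of [ribaucour_pot_potential]. *)
Lemma egoroff_net_potential (E : net R N D) :
  (smooth_on U (net_x E) /\
   forall i u, U u -> pderiv i (net_x E) u = net_H E i u *: net_X E i u) <->
  is_potential U (net_X E) (scalar_row (net_H E)) (net_x E).
Proof.
split=> -[x_smooth x_der]; split=> // i u Uu; rewrite x_der //;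
  by rewrite mul_mx_scalar.
Qed.

Variables (E : net R N D) (xi : 'I_N -> 'rV[R]_N -> 'cV[R]_n) (L : 'M[R]_n).
Variables (Om : 'rV[R]_N -> 'M[R]_n) (OmX : 'rV[R]_N -> 'M[R]_(D, n)).
Variable OmH : 'rV[R]_N -> 'cV[R]_n.

Lemma scalar_row_ribaucour :
  scalar_row (net_H (ribaucour E xi L Om OmX OmH)) =
  ribaucour_row (costar xi L) Om OmH (scalar_row (net_H E)).
Proof.
apply/funext => i; apply/funext => u.
rewrite /scalar_row /ribaucour_row /=; move: (_ *m _ *m _) => M.
by apply/matrixP => a b; rewrite !ord1 !mxE eqxx !mulr1n.
Qed.

Hypothesis data : ribaucour_data U E xi L Om OmX OmH.

(** The result of the first step must itself be an Egoroff net for the second step to be defined. *)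
Lemma ribaucour_egoroff : egoroff_net U (ribaucour E xi L Om OmX OmH).
Proof.
have [[E_de X_sol H_sol /egoroff_net_potential x_pot] xi_sol xi_costar Om_pot
  OmX_pot OmH_pot Om_unit Om_L Om_sym] := data.
have xis_sol := costar_row_solution U_open (de_sym E_de) L xi_sol.
split.
- exact: (darboux_egoroff_ribaucour_beta U_open (de_sym E_de) xi_sol
    xi_costar Om_pot Om_unit Om_L Om_sym E_de).
- exact: (ribaucour_col_solution U_open Om_pot Om_unit xi_sol X_sol OmX_pot).
- apply/scalar_row_solutionP; rewrite scalar_row_ribaucour.
  apply: (ribaucour_row_solution U_open Om_pot Om_unit xis_sol _ OmH_pot).
  exact/scalar_row_solutionP.
- apply/egoroff_net_potential; rewrite scalar_row_ribaucour.
  exact: (ribaucour_pot_potential U_open Om_pot Om_unit OmX_pot OmH_pot x_pot).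
Qed.

End TransformedNet.

(** * Composition *)

Section SchurComplement.
Variables (F : fieldType) (n1 n2 : nat).
Variables (A11 : 'M[F]_n1) (A12 : 'M[F]_(n1, n2)).
Variables (A21 : 'M[F]_(n2, n1)) (A22 : 'M[F]_n2).
Hypothesis A22_unit : A22 \in unitmx.
Let A := block_mx A11 A12 A21 A22.
Let S := A11 - A12 *m invmx A22 *m A21.

Lemma unitmx_schur : (A \in unitmx) = (S \in unitmx).
Proof.
(* Block elimination: the first factor has determinant 1, hence det A = det S det A22. *)
have -> : A = block_mx 1%:M (A12 *m invmx A22) 0 1%:M *m block_mx S 0 A21 A22.
  rewrite mulmx_block !mul1mx !mul0mx !add0r mulmxKV //.
  by rewrite addrNK.
rewrite !unitmxE det_mulmx det_ublock det_lblock !det1 !mul1r.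
by rewrite unitrM -[_ \is a _ in X in _ && X]unitmxE A22_unit andbT.
Qed.

(** Solving A y = c by eliminating the second block gives [y1] through S and then [y2] by back
    substitution; multiplying y by the row (r1, r2) and collecting the terms in [y1] gives the
    formula. Its two summands are the corrections of the two steps. *)
Lemma mul_invmx_block p q (r1 : 'M[F]_(p, n1)) (r2 : 'M[F]_(p, n2))
    (c1 : 'M[F]_(n1, q)) (c2 : 'M[F]_(n2, q)) :
  A \in unitmx ->
  row_mx r1 r2 *m invmx A *m col_mx c1 c2 =
  r2 *m invmx A22 *m c2 +
  (r1 - r2 *m invmx A22 *m A21) *m invmx S *m (c1 - A12 *m invmx A22 *m c2).
Proof.
move=> A_unit; have S_unit : S \in unitmx by rewrite -unitmx_schur.
pose y1 := invmx S *m (c1 - A12 *m invmx A22 *m c2).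
pose y2 := invmx A22 *m (c2 - A21 *m y1).
have Ay : A *m col_mx y1 y2 = col_mx c1 c2.
  rewrite mul_block_col; congr col_mx; last first.
    by rewrite /y2 mulKVmx // addrC subrK.
  have -> : A11 = S + A12 *m invmx A22 *m A21 by rewrite subrK.
  rewrite mulmxDl mulKVmx // /y2 !mulmxBr !mulmxA.
  by rewrite -addrA [X in _ + X]addrC !subrK.
rewrite -mulmxA -Ay mulKmx // mul_row_col -[in RHS](mulmxA _ (invmx S)) -/y1.
rewrite mulmxBl /y2; move: y1 {y2 Ay} => y1.
by rewrite !mulmxBr !mulmxA addrCA.
Qed.

End SchurComplement.

(** * Direct sums of solutions and of potentials *)

Section Blocks.
Variables (R : realType) (N : nat) (U : set 'rV[R]_N).
Hypothesis U_open : open U.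

Lemma sum_col_mx (I : Type) (r : seq I) (P : pred I) m1 m2 n
    (f1 : I -> 'M[R]_(m1, n)) (f2 : I -> 'M[R]_(m2, n)) :
  \sum_(k <- r | P k) col_mx (f1 k) (f2 k) =
  col_mx (\sum_(k <- r | P k) f1 k) (\sum_(k <- r | P k) f2 k).
Proof.
elim: r => [|k r IHr]; first by rewrite !big_nil col_mx0.
by rewrite !big_cons; case: (P k); rewrite IHr ?add_col_mx.
Qed.

Lemma sum_row_mx (I : Type) (r : seq I) (P : pred I) m n1 n2
    (f1 : I -> 'M[R]_(m, n1)) (f2 : I -> 'M[R]_(m, n2)) :
  \sum_(k <- r | P k) row_mx (f1 k) (f2 k) =
  row_mx (\sum_(k <- r | P k) f1 k) (\sum_(k <- r | P k) f2 k).
Proof.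
elim: r => [|k r IHr]; first by rewrite !big_nil row_mx0.
by rewrite !big_cons; case: (P k); rewrite IHr ?add_row_mx.
Qed.

Lemma pderiv_col_mx m1 m2 n (f1 : 'rV[R]_N -> 'M[R]_(m1, n))
    (f2 : 'rV[R]_N -> 'M[R]_(m2, n)) i u :
  smooth_on U f1 -> smooth_on U f2 -> U u ->
  pderiv i (fun w => col_mx (f1 w) (f2 w)) u =
  col_mx (pderiv i f1 u) (pderiv i f2 u).
Proof.
move=> f1_smooth f2_smooth Uu.
have f_smooth := smooth_col_mx U_open f1_smooth f2_smooth.
apply/matrixP => a b; rewrite -(pderiv_mx i a b f_smooth Uu).
case: (split_ordP a) => c ->; rewrite ?col_mxEu ?col_mxEd.
  rewrite -(pderiv_mx i c b f1_smooth Uu).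
  by congr (pderiv i _ u); apply/funext => w; rewrite col_mxEu.
rewrite -(pderiv_mx i c b f2_smooth Uu).
by congr (pderiv i _ u); apply/funext => w; rewrite col_mxEd.
Qed.

Lemma pderiv_row_mx m n1 n2 (f1 : 'rV[R]_N -> 'M[R]_(m, n1))
    (f2 : 'rV[R]_N -> 'M[R]_(m, n2)) i u :
  smooth_on U f1 -> smooth_on U f2 -> U u ->
  pderiv i (fun w => row_mx (f1 w) (f2 w)) u =
  row_mx (pderiv i f1 u) (pderiv i f2 u).
Proof.
move=> f1_smooth f2_smooth Uu.
have f_smooth := smooth_row_mx U_open f1_smooth f2_smooth.
apply/matrixP => a b; rewrite -(pderiv_mx i a b f_smooth Uu).
case: (split_ordP b) => c ->; rewrite ?row_mxEl ?row_mxEr.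
  rewrite -(pderiv_mx i a c f1_smooth Uu).
  by congr (pderiv i _ u); apply/funext => w; rewrite row_mxEl.
rewrite -(pderiv_mx i a c f2_smooth Uu).
by congr (pderiv i _ u); apply/funext => w; rewrite row_mxEr.
Qed.

Lemma is_potential_col_mx m1 m2 n
    (eta1 : 'I_N -> 'rV[R]_N -> 'cV[R]_m1) (eta2 : 'I_N -> 'rV[R]_N -> 'cV[R]_m2)
    (theta : 'I_N -> 'rV[R]_N -> 'rV[R]_n) A1 A2 :
  is_potential U eta1 theta A1 -> is_potential U eta2 theta A2 ->
  is_potential U (fun i u => col_mx (eta1 i u) (eta2 i u)) theta
    (fun u => col_mx (A1 u) (A2 u)).
Proof.
move=> [A1_smooth A1_der] [A2_smooth A2_der].
split=> [|i u Uu]; first exact: smooth_col_mx.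
by rewrite pderiv_col_mx // A1_der // A2_der // mul_col_mx.
Qed.

Lemma is_potential_row_mx m n1 n2
    (eta : 'I_N -> 'rV[R]_N -> 'cV[R]_m) (theta1 : 'I_N -> 'rV[R]_N -> 'rV[R]_n1)
    (theta2 : 'I_N -> 'rV[R]_N -> 'rV[R]_n2) A1 A2 :
  is_potential U eta theta1 A1 -> is_potential U eta theta2 A2 ->
  is_potential U eta (fun i u => row_mx (theta1 i u) (theta2 i u))
    (fun u => row_mx (A1 u) (A2 u)).
Proof.
move=> [A1_smooth A1_der] [A2_smooth A2_der].
split=> [|i u Uu]; first exact: smooth_row_mx.
by rewrite pderiv_row_mx // A1_der // A2_der // mul_mx_row.
Qed.

Lemma column_solution_col_mx m1 m2 (beta : 'I_N -> 'I_N -> 'rV[R]_N -> R^o)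
    (xi1 : 'I_N -> 'rV[R]_N -> 'cV[R]_m1) (xi2 : 'I_N -> 'rV[R]_N -> 'cV[R]_m2) :
  column_solution U beta xi1 -> column_solution U beta xi2 ->
  column_solution U beta (fun i u => col_mx (xi1 i u) (xi2 i u)).
Proof.
move=> [xi1_smooth xi1_der] [xi2_smooth xi2_der].
split=> [i|i j ij u Uu]; first exact: smooth_col_mx.
by rewrite pderiv_col_mx // xi1_der // xi2_der // scale_col_mx.
Qed.

Lemma costar_block m1 m2
    (xi1 : 'I_N -> 'rV[R]_N -> 'cV[R]_m1) (xi2 : 'I_N -> 'rV[R]_N -> 'cV[R]_m2)
    (L1 : 'M[R]_m1) (L2 : 'M[R]_m2) :
  costar (fun i u => col_mx (xi1 i u) (xi2 i u)) (block_mx L1 0 0 L2) =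
  fun i u => row_mx (costar xi1 L1 i u) (costar xi2 L2 i u).
Proof.
apply/funext => i; apply/funext => u.
by rewrite /costar tr_col_mx mul_row_block !mulmx0 addr0 add0r.
Qed.

Lemma costar_condition_block m1 m2
    (beta : 'I_N -> 'I_N -> 'rV[R]_N -> R^o)
    (xi1 : 'I_N -> 'rV[R]_N -> 'cV[R]_m1) (xi2 : 'I_N -> 'rV[R]_N -> 'cV[R]_m2)
    (L1 : 'M[R]_m1) (L2 : 'M[R]_m2) :
  (forall i, smooth_on U (xi1 i)) -> (forall i, smooth_on U (xi2 i)) ->
  costar_condition U beta xi1 L1 -> costar_condition U beta xi2 L2 ->
  costar_condition U beta (fun i u => col_mx (xi1 i u) (xi2 i u))
    (block_mx L1 0 0 L2).
Proof.
move=> xi1_smooth xi2_smooth xi1_costar xi2_costar i u Uu.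
rewrite costar_block xi1_costar // xi2_costar // pderiv_col_mx //.
under [in RHS]eq_bigr do rewrite scale_col_mx.
by rewrite sum_col_mx add_col_mx tr_col_mx.
Qed.

End Blocks.

(** * The two successive transformations *)

Section TwoSteps.
Variables (R : realType) (N D n1 n2 : nat) (U : set 'rV[R]_N).
Hypothesis U_open : open U.
Variables (E : net R N D) (E_net : egoroff_net U E).
Variables (xi1 : 'I_N -> 'rV[R]_N -> 'cV[R]_n1) (L1 : 'M[R]_n1).
Variables (xi2 : 'I_N -> 'rV[R]_N -> 'cV[R]_n2) (L2 : 'M[R]_n2).
Hypothesis xi1_sol : column_solution U (net_beta E) xi1.
Hypothesis xi1_costar : costar_condition U (net_beta E) xi1 L1.
Variables (Om11 : 'rV[R]_N -> 'M[R]_n1) (Om12 : 'rV[R]_N -> 'M[R]_(n1, n2)).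
Variables (Om21 : 'rV[R]_N -> 'M[R]_(n2, n1)) (Om22 : 'rV[R]_N -> 'M[R]_n2).
Variables (OmX1 : 'rV[R]_N -> 'M[R]_(D, n1)) (OmX2 : 'rV[R]_N -> 'M[R]_(D, n2)).
Variables (OmH1 : 'rV[R]_N -> 'cV[R]_n1) (OmH2 : 'rV[R]_N -> 'cV[R]_n2).
Hypothesis data2 : ribaucour_data U E xi2 L2 Om22 OmX2 OmH2.
Hypothesis Om11_pot : is_potential U xi1 (costar xi1 L1) Om11.
Hypothesis Om12_pot : is_potential U xi1 (costar xi2 L2) Om12.
Hypothesis Om21_pot : is_potential U xi2 (costar xi1 L1) Om21.
Hypothesis OmX1_pot : is_potential U (net_X E) (costar xi1 L1) OmX1.
Hypothesis OmH1_pot : is_potential U xi1 (scalar_row (net_H E)) OmH1.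
Let Om u := block_mx (Om11 u) (Om12 u) (Om21 u) (Om22 u).
Hypothesis Om_unit : forall u, U u -> Om u \in unitmx.
Hypothesis Om11_L : forall u, U u -> L1^T *m Om11 u = (Om11 u)^T *m L1.
Hypothesis Om12_L : forall u, U u -> L1^T *m Om12 u = (Om21 u)^T *m L2.
Hypothesis Om11_sym : forall u, U u ->
  Om11 u + (Om11 u)^T = \sum_(k < N) xi1 k u *m (xi1 k u)^T.
Hypothesis Om12_sym : forall u, U u ->
  Om12 u + (Om21 u)^T = \sum_(k < N) xi1 k u *m (xi2 k u)^T.

Let E' := ribaucour E xi2 L2 Om22 OmX2 OmH2.
Let xi1' := ribaucour_col xi2 Om22 Om12 xi1.
Let Om11' := ribaucour_pot Om22 Om12 Om21 Om11.
Let OmX1' := ribaucour_pot Om22 OmX2 Om21 OmX1.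
Let OmH1' := ribaucour_pot Om22 Om12 OmH2 OmH1.

(** Transposing [Om12_L] gives Om12^t L1 = L2^t Om21, and L2 Om22^-1 is symmetric; together they
    turn (Om12 Om22^-1 xi_2)^t L1 into xi_2^t L2 Om22^-1 Om21. *)
Lemma ribaucour_row_costar i u : U u ->
  ribaucour_row (costar xi2 L2) Om22 Om21 (costar xi1 L1) i u
  = costar xi1' L1 i u.
Proof.
case: data2 => _ _ _ _ _ _ Om22_unit Om22_L _ Uu.
have L2_sym := mul_invmx_sym (Om22_unit u Uu) (Om22_L u Uu).
rewrite /ribaucour_row /costar /xi1' /ribaucour_col linearB /= mulmxBl.
congr (_ - _); rewrite !trmx_mul -!mulmxA; congr (_ *m _).
have -> : (Om12 u)^T *m L1 = L2^T *m Om21 u.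
  by rewrite -[L1]trmxK -trmx_mul Om12_L // trmx_mul trmxK.
by rewrite !mulmxA -{1}L2_sym trmx_mul.
Qed.

(** The transformed [beta] is symmetric, so by [costar_conditionP] the claim is D xi1' = L1^t xi1',
    with D the sum of all partial derivatives. It holds for xi1, and the correction Om12 Om22^-1 xi2
    satisfies the same equation. *)
Lemma ribaucour_col_costar_condition :
  costar_condition U (net_beta E') xi1' L1.
Proof.
have E'_net : egoroff_net U E' := ribaucour_egoroff U_open data2.
case: (E_net) => E_de _ _ _; case: E'_net => E'_de _ _ _.
case: data2 => _ xi2_sol xi2_costar Om22_pot _ _ Om22_unit Om22_L Om22_sym.
have xi1'_sol : column_solution U (net_beta E') xi1'.
  exact: (ribaucour_col_solution U_open Om22_pot Om22_unit xi2_sol xi1_sol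
    Om12_pot).
apply/(costar_conditionP (de_sym E'_de) L1 xi1'_sol) => i u Uu.
have [Om12_smooth Om12_der] := Om12_pot.
have [xi1_smooth _] := xi1_sol; have [xi2_smooth _] := xi2_sol.
have Q_smooth := smooth_mul_invmx U_open Om22_pot Om22_unit Om12_smooth
  (xi2_smooth i).
have D_xi1 := (costar_conditionP (de_sym E_de) L1 xi1_sol).1 xi1_costar.
have D_xi2 := (costar_conditionP (de_sym E_de) L2 xi2_sol).1 xi2_costar.
(* By [Om12_sym] the sum of derivatives is (Om12 + Om21^t) L2, and Om21^t L2 = L1^t Om12. *)
have D_Om12 : \sum_k pderiv k Om12 u - Om12 u *m L2 = L1^T *m Om12 u.
  rewrite Om12_L //; apply/eqP; rewrite subr_eq addrC -mulmxDl; apply/eqP.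
  rewrite Om12_sym // mulmx_suml; apply: eq_bigr => k _.
  by rewrite Om12_der // mulmxA.
rewrite (eq_bigr _ (fun k _ => pderivB k (xi1_smooth i) Q_smooth Uu)).
rewrite sumrB D_xi1 // (sum_pderiv_mul_invmx U_open Om22_pot Om22_unit Om22_L
  Om22_sym Om12_smooth (xi2_smooth i) Uu).
rewrite D_xi2 // subrr mulmx0 addr0 D_Om12.
by rewrite mulmxBr !mulmxA.
Qed.

Lemma ribaucour_data_step2 : ribaucour_data U E' xi1' L1 Om11' OmX1' OmH1'.
Proof.
have E'_net : egoroff_net U E' := ribaucour_egoroff U_open data2.
case: data2 => _ xi2_sol xi2_costar Om22_pot OmX2_pot OmH2_pot Om22_unit Om22_L
  Om22_sym.
have potential_costar p (eta : 'I_N -> 'rV[R]_N -> 'cV[R]_p) B :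
    is_potential U eta (ribaucour_row (costar xi2 L2) Om22 Om21
      (costar xi1 L1)) B ->
    is_potential U eta (costar xi1' L1) B.
  move=> [B_smooth B_der]; split=> // i u Uu.
  by rewrite B_der // ribaucour_row_costar.
split=> //.
- exact: (ribaucour_col_solution U_open Om22_pot Om22_unit xi2_sol xi1_sol
    Om12_pot).
- exact: ribaucour_col_costar_condition.
- apply: potential_costar.
  exact: (ribaucour_pot_potential U_open Om22_pot Om22_unit Om12_pot Om21_pot
    Om11_pot).
- apply: potential_costar.
  exact: (ribaucour_pot_potential U_open Om22_pot Om22_unit OmX2_pot Om21_pot
    OmX1_pot).
- rewrite scalar_row_ribaucour.
  exact: (ribaucour_pot_potential U_open Om22_pot Om22_unit Om12_pot OmH2_pot
    OmH1_pot).
- by move=> u Uu; rewrite -unitmx_schur ?Om22_unit //; exact: Om_unit.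
(* On both sides the correction equals Om21^t (L2 Om22^-1) Om21, by the symmetry of L2 Om22^-1. *)
- move=> u Uu; have L2_sym := mul_invmx_sym (Om22_unit u Uu) (Om22_L u Uu).
  rewrite /Om11' /ribaucour_pot mulmxBr Om11_L // [(_ - _)^T]linearB /= mulmxBl.
  congr (_ - _); rewrite !mulmxA Om12_L // !trmx_mul -!mulmxA; congr (_ *m _).
  have -> : (Om12 u)^T *m L1 = L2^T *m Om21 u.
    by rewrite -[L1]trmxK -trmx_mul Om12_L // trmx_mul trmxK.
  by rewrite !mulmxA -{1}L2_sym trmx_mul.
move=> u Uu; rewrite /Om11' /xi1' /ribaucour_pot /ribaucour_col.
(* With xi1' = xi1 - P xi2 the sum of squares expands into four sums, each known from a block of Om
   + Om^t. The quadratic one equals P Om12^t + Om12 P^t and cancels the Om12 parts of the mixed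
   ones. *)
set Oi := invmx (Om22 u); pose P := Om12 u *m Oi.
have Oi_sym : Oi *m (Om22 u + (Om22 u)^T) *m Oi^T = Oi + Oi^T.
  rewrite mulmxDr mulVmx ?Om22_unit // mulmxDl mul1mx addrC; congr (_ + _).
  by rewrite -mulmxA -trmx_mul mulVmx ?Om22_unit // trmx1 mulmx1.
have Om21_sym : Om21 u + (Om12 u)^T = \sum_(k < N) xi2 k u *m (xi1 k u)^T.
  rewrite -[LHS]trmxK linearD /= trmxK addrC Om12_sym // raddf_sum /=.
  by apply: eq_bigr => k _; rewrite trmx_mul trmxK.
transitivity (Om11 u + (Om11 u)^T - (Om12 u + (Om21 u)^T) *m P^T
    - P *m (Om21 u + (Om12 u)^T) + P *m (Om22 u + (Om22 u)^T) *m P^T); last first.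
  rewrite Om11_sym // Om12_sym // Om21_sym Om22_sym // !mulmx_suml.
  rewrite !mulmx_sumr !mulmx_suml -!sumrB -big_split /=.
  apply: eq_bigr => k _; rewrite -/P linearB /= mulmxBl !mulmxBr.
  by rewrite (trmx_mul P) !mulmxA opprB addrA [RHS]addrAC.
have -> : P *m (Om22 u + (Om22 u)^T) *m P^T =
    P *m (Om12 u)^T + Om12 u *m P^T.
  transitivity (Om12 u *m (Oi *m (Om22 u + (Om22 u)^T) *m Oi^T) *m (Om12 u)^T).
    by rewrite /P trmx_mul !mulmxA.
  by rewrite Oi_sym mulmxDr mulmxDl /P trmx_mul !mulmxA.
rewrite linearB /= trmx_mul mulmxDl mulmxDr -/P.
move: (_ *m P^T) (_ *m P^T) (P *m _) (P *m _) => M1 M2 M3 M4.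
apply/matrixP => i j; rewrite !mxE; ring.
Qed.

Lemma ribaucour_composition :
  net_eq_on U
    (ribaucour E (fun i u => col_mx (xi1 i u) (xi2 i u)) (block_mx L1 0 0 L2) Om
      (fun u => row_mx (OmX1 u) (OmX2 u)) (fun u => col_mx (OmH1 u) (OmH2 u)))
    (ribaucour E' xi1' L1 Om11' OmX1' OmH1').
Proof.
case: data2 => _ _ _ _ _ _ Om22_unit _ _ u Uu.
have block := mul_invmx_block (Om22_unit u Uu) _ _ _ _ (Om_unit Uu).
split=> [i j _|i|i|] /=.
- rewrite costar_block block -ribaucour_row_costar //.
  by rewrite [X in _ - X]mxE opprD addrA.
- by rewrite /ribaucour_col block opprD addrA.
- rewrite costar_block block -ribaucour_row_costar //.
  by rewrite [X in _ - X]mxE opprD addrA.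
by rewrite /ribaucour_pot block opprD addrA.
Qed.

End TwoSteps.

Theorem mainTheorem5 (R : realType) (N D n1 n2 : nat) (U : set 'rV[R]_N)
    (U_open : open U)
    (E : net R N D) (E_net : egoroff_net U E)
    (xi1 : 'I_N -> 'rV[R]_N -> 'cV[R]_n1) (L1 : 'M[R]_n1)
    (xi2 : 'I_N -> 'rV[R]_N -> 'cV[R]_n2) (L2 : 'M[R]_n2)
    (xi1_sol : column_solution U (net_beta E) xi1)
    (xi2_sol : column_solution U (net_beta E) xi2)
    (xi1_costar : costar_condition U (net_beta E) xi1 L1)
    (xi2_costar : costar_condition U (net_beta E) xi2 L2)
    (Om11 : 'rV[R]_N -> 'M[R]_(n1, n1)) (Om12 : 'rV[R]_N -> 'M[R]_(n1, n2))
    (Om21 : 'rV[R]_N -> 'M[R]_(n2, n1)) (Om22 : 'rV[R]_N -> 'M[R]_(n2, n2))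
    (OmX1 : 'rV[R]_N -> 'M[R]_(D, n1)) (OmX2 : 'rV[R]_N -> 'M[R]_(D, n2))
    (OmH1 : 'rV[R]_N -> 'cV[R]_n1) (OmH2 : 'rV[R]_N -> 'cV[R]_n2)
    (Om11_pot : is_potential U xi1 (costar xi1 L1) Om11)
    (Om12_pot : is_potential U xi1 (costar xi2 L2) Om12)
    (Om21_pot : is_potential U xi2 (costar xi1 L1) Om21)
    (Om22_pot : is_potential U xi2 (costar xi2 L2) Om22)
    (OmX1_pot : is_potential U (net_X E) (costar xi1 L1) OmX1)
    (OmX2_pot : is_potential U (net_X E) (costar xi2 L2) OmX2)
    (OmH1_pot : is_potential U xi1 (scalar_row (net_H E)) OmH1)
    (OmH2_pot : is_potential U xi2 (scalar_row (net_H E)) OmH2) :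
  let xi := fun i u => col_mx (xi1 i u) (xi2 i u) in
  let L := block_mx L1 0 0 L2 in
  let Om := fun u => block_mx (Om11 u) (Om12 u) (Om21 u) (Om22 u) in
  let OmX := fun u => row_mx (OmX1 u) (OmX2 u) in
  let OmH := fun u => col_mx (OmH1 u) (OmH2 u) in
  (forall u, U u -> L^T *m Om u = (Om u)^T *m L) ->
  (forall u, U u -> Om u + (Om u)^T = \sum_(k < N) xi k u *m (xi k u)^T) ->
  (forall u, U u -> Om u \in unitmx) ->
  (forall u, U u -> Om22 u \in unitmx) ->
  let E' := ribaucour E xi2 L2 Om22 OmX2 OmH2 in
  let xi1' := ribaucour_col xi2 Om22 Om12 xi1 in
  let Om11' := ribaucour_pot Om22 Om12 Om21 Om11 in
  let OmX1' := ribaucour_pot Om22 OmX2 Om21 OmX1 in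
  let OmH1' := ribaucour_pot Om22 Om12 OmH2 OmH1 in
  [/\ ribaucour_data U E xi L Om OmX OmH,
      ribaucour_data U E xi2 L2 Om22 OmX2 OmH2,
      ribaucour_data U E' xi1' L1 Om11' OmX1' OmH1',
      (forall i u, U u ->
         ribaucour_row (costar xi2 L2) Om22 Om21 (costar xi1 L1) i u
         = costar xi1' L1 i u) &
      net_eq_on U (ribaucour E xi L Om OmX OmH)
                  (ribaucour E' xi1' L1 Om11' OmX1' OmH1')].
Proof.
move=> xi L Om OmX OmH Om_L Om_sym Om_unit Om22_unit E' xi1' Om11' OmX1' OmH1'.
have [xi1_smooth _] := xi1_sol; have [xi2_smooth _] := xi2_sol.
(* Both conditions on Om are split into blocks; each (2,1) block is the transpose of the
   corresponding (1,2) block. *)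
have L_blocks u : U u ->
    [/\ L1^T *m Om11 u = (Om11 u)^T *m L1, L1^T *m Om12 u = (Om21 u)^T *m L2 &
        L2^T *m Om22 u = (Om22 u)^T *m L2].
  move=> Uu; have := Om_L u Uu; rewrite /L /Om !tr_block_mx !trmx0 !mulmx_block.
  by rewrite !mul0mx !mulmx0 !addr0 !add0r => /eq_block_mx[].
have sym_blocks u : U u ->
    [/\ Om11 u + (Om11 u)^T = \sum_(k < N) xi1 k u *m (xi1 k u)^T,
        Om12 u + (Om21 u)^T = \sum_(k < N) xi1 k u *m (xi2 k u)^T &
        Om22 u + (Om22 u)^T = \sum_(k < N) xi2 k u *m (xi2 k u)^T].
  move=> Uu; have := Om_sym u Uu; rewrite /xi /Om tr_block_mx add_block_mx.
  under eq_bigr do rewrite tr_col_mx mul_col_row.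
  by rewrite /block_mx sum_col_mx !sum_row_mx => /eq_block_mx[].
have xi_sol : column_solution U (net_beta E) xi.
  exact: column_solution_col_mx.
have xis_block : costar xi L = fun i u =>
    row_mx (costar xi1 L1 i u) (costar xi2 L2 i u) by exact: costar_block.
(* The conditions of the first step on Om22 are the (2,2) blocks of those on Om. *)
have data2 : ribaucour_data U E xi2 L2 Om22 OmX2 OmH2.
  by split=> // u Uu; [case: (L_blocks u Uu)|case: (sym_blocks u Uu)].
have Om11_L u : U u -> L1^T *m Om11 u = (Om11 u)^T *m L1.
  by move=> /L_blocks[].
have Om12_L u : U u -> L1^T *m Om12 u = (Om21 u)^T *m L2.
  by move=> /L_blocks[].
have Om11_sym u : U u ->
    Om11 u + (Om11 u)^T = \sum_(k < N) xi1 k u *m (xi1 k u)^T.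
  by move=> /sym_blocks[].
have Om12_sym u : U u ->
    Om12 u + (Om21 u)^T = \sum_(k < N) xi1 k u *m (xi2 k u)^T.
  by move=> /sym_blocks[].
split=> //.
- split=> //.
  + exact: costar_condition_block.
  + rewrite xis_block; apply: is_potential_col_mx => //;
      exact: is_potential_row_mx.
  + by rewrite xis_block; exact: is_potential_row_mx.
  + exact: is_potential_col_mx.
- exact: ribaucour_data_step2.
- by move=> i u Uu; exact: (ribaucour_row_costar xi1 data2 Om12_L i Uu).
- exact: (ribaucour_composition xi1 OmX1 OmH1 data2 Om_unit Om12_L).
Qed.
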